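(* Let $a_1,\dots,a_{15}$ be fifteen vertices and let $G^4_0$ be the graph on these vertices with the $30$ edges $a_{15}a_4, a_{15}a_{11}, a_{15}a_{12}, a_{15}a_3, a_{14}a_2, a_{14}a_{10}, a_{14}a_{13}, a_{14}a_5, a_{13}a_6, a_{13}a_8, a_{13}a_5, a_{12}a_3, a_{12}a_9, a_{12}a_7, a_{11}a_4, a_{11}a_8, a_{11}a_9, a_{10}a_2, a_{10}a_7, a_{10}a_6, a_9a_8, a_9a_7, a_8a_6, a_7a_6, a_5a_1, a_5a_4, a_4a_1, a_3a_1, a_3a_2, a_2a_1$. Put $v_0^0:=a_{14}$, $v_1^0:=a_2$, $v_2^0:=a_{10}$ (these form a triangle). For $i>0$, given $G^4_{i-1}$ containing the triangle $v_0^{i-1}v_1^{i-1}v_2^{i-1}$, let $G^4_i$ be the graph with vertex set $V(G^4_{i-1})\cup\{v_0^i,v_1^i,v_2^i\}$ (three new vertices) and edge set $$\bigl(E(G^4_{i-1})\setminus\{v_0^{i-1}v_1^{i-1},v_1^{i-1}v_2^{i-1},v_2^{i-1}v_0^{i-1}\}\bigr)\cup\{v_0^iv_1^i,v_1^iv_2^i,v_2^iv_0^i\}\cup\{v_0^iv_1^{i-1},v_0^iv_2^{i-1},v_1^iv_0^{i-1},v_1^iv_2^{i-1},v_2^iv_0^{i-1},v_2^iv_1^{i-1}\}.$$ Let $\mathcal{G}:=\{G^4_i\mid i\ge 0\}$. Then for every graph $G\in\mathcal{G}$, $\chi_i(G)=8$.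
   Context: All graphs are simple and undirected. For $k>0$, an injective $k$-colouring of a graph $G$ is a map $c:V(G)\to\{1,\dots,k\}$ such that any two distinct vertices having a common neighbour receive different colours. The injective chromatic number $\chi_i(G)$ is the smallest $k$ for which $G$ has an injective $k$-colouring. *)

(* Defs.v *)
From mathcomp Require Import all_boot.

Set Implicit Arguments.
Unset Strict Implicit.
Unset Printing Implicit Defensive.

Record sgraph := SGraph {
  vertex :> finType;
  edge : rel vertex;
  edge_sym : symmetric edge;
  edge_irr : irreflexive edge }.

Section InjectiveColouring.

Variable G : sgraph.

Definition common_neighbour (x y : G) : bool :=
  [exists z, edge x z && edge y z].

(* Colours are numbered from 0 to k - 1. *)
Definition injective_colouring (k : nat) (c : {ffun G -> 'I_k}) : bool :=
  [forall x, forall y, (x != y) && common_neighbour x y ==> (c x != c y)].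

Definition injectively_colourable (k : nat) : bool :=
  [exists c : {ffun G -> 'I_k}, injective_colouring c].

Lemma ex_injectively_colourable :
  exists k, (0 < k) && injectively_colourable k.
Proof.
exists #|G|.+1; rewrite /=; apply/existsP.
exists [ffun x => widen_ord (leqnSn _) (enum_rank x)].
apply/forallP=> x; apply/forallP=> y; apply/implyP=> /andP[xy _].
rewrite !ffunE; apply: contraNneq xy => /(congr1 val) /= xy.
by apply/eqP/enum_rank_inj/val_inj.
Qed.

Definition injective_chromatic_number : nat :=
  ex_minn ex_injectively_colourable.

End InjectiveColouring.

Definition G40_edges : seq (nat * nat) :=
  [:: (15, 4); (15, 11); (15, 12); (15, 3);
      (14, 2); (14, 10); (14, 13); (14, 5);
      (13, 6); (13, 8); (13, 5);
      (12, 3); (12, 9); (12, 7);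
      (11, 4); (11, 8); (11, 9);
      (10, 2); (10, 7); (10, 6);
      (9, 8); (9, 7);
      (8, 6);
      (7, 6);
      (5, 1); (5, 4);
      (4, 1);
      (3, 1); (3, 2);
      (2, 1)].

(* The vertex a_j is the element of 'I_15 of value j - 1. *)
Definition G40_edge : rel 'I_15 :=
  fun x y => ((x.+1, y.+1) \in G40_edges) || ((y.+1, x.+1) \in G40_edges).

Lemma G40_edge_sym : symmetric G40_edge.
Proof. by move=> x y; rewrite /G40_edge orbC. Qed.

Lemma G40_edge_irr : irreflexive G40_edge.
Proof. by case; do 15?case. Qed.

Definition G40 : sgraph := SGraph G40_edge_sym G40_edge_irr.

(* v_0 = a_14, v_1 = a_2, v_2 = a_10 *)
Definition G40_triangle (j : 'I_3) : G40 :=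
  match val j with
  | 0 => @Ordinal 15 13 isT
  | 1 => @Ordinal 15 1 isT
  | _ => @Ordinal 15 9 isT
  end.

Section Step.

Variables (G : sgraph) (v : 'I_3 -> G).

(* inl embeds the old vertices; inr j is the new vertex v_j. *)
Definition step_edge : rel (G + 'I_3)%type := fun x y =>
  match x, y with
  | inl p, inl q =>
      edge p q && ~~ [exists j, exists k, [&& j != k, p == v j & q == v k]]
  | inr j, inr k => j != k
  | inr j, inl p | inl p, inr j => [exists k, (j != k) && (p == v k)]
  end.

Lemma step_edge_sym : symmetric step_edge.
Proof.
move=> [p|j] [q|k] //=; last by rewrite eq_sym.
rewrite edge_sym; congr (_ && ~~ _).
by apply/existsP/existsP=> -[j /existsP[k /and3P[jk pj qk]]];
  exists k; apply/existsP; exists j; rewrite eq_sym jk pj qk.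
Qed.

Lemma step_edge_irr : irreflexive step_edge.
Proof. by move=> [p|j] /=; rewrite ?edge_irr ?eqxx. Qed.

Definition step : sgraph := SGraph step_edge_sym step_edge_irr.

Definition step_triangle (j : 'I_3) : step := inr j.

End Step.

Fixpoint G4_pointed (i : nat) : {G : sgraph & 'I_3 -> G} :=
  match i with
  | 0 => existT (fun G : sgraph => 'I_3 -> G) G40 G40_triangle
  | i'.+1 =>
      existT (fun G : sgraph => 'I_3 -> G)
        (step (projT2 (G4_pointed i'))) (step_triangle (projT2 (G4_pointed i')))
  end.

Definition G4 (i : nat) : sgraph := projT1 (G4_pointed i).

Definition G4_triangle (i : nat) : 'I_3 -> G4 i := projT2 (G4_pointed i).

Lemma G4_triangleP (i : nat) (j k : 'I_3) :
  edge (G4_triangle i j) (G4_triangle i k) = (j != k).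
Proof. by case: i => [|i] //; case: j => -[|[|[]]] //; case: k => -[|[|[]]]. Qed.

Definition G4_family (G : sgraph) : Prop := exists i : nat, G = G4 i.

(* Main.v *)
(** Only the colours on the successive triangles matter beyond [G40].  Let the
    open step of (G, v) be the step graph with the edges of its new triangle
    erased.  It is the subgraph of the second step induced on the vertices of
    the first, and sending each new vertex to the corresponding v_j is a locally
    injective homomorphism from it to G.  Injective colourings pull back along
    locally injective homomorphisms, so an injective 7-colouring of any [G4 i]
    yields one of the open step of [G40]; an exhaustive search shows that the
    latter graph, with 18 vertices, has none.  Conversely, an injective
    colouring of G with at least 6 colours extends over two steps: repeat the
    colours of v on the first new triangle and use three other colours on the
    second.  Hence 8-colourings of [G4 0] and [G4 1] suffice. *)

Require Import Defs.
From mathcomp Require Import all_boot.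

Set Implicit Arguments.
Unset Strict Implicit.
Unset Printing Implicit Defensive.

(** * Injective colourings as locally injective maps *)

Section LocallyInjective.

Definition locally_injective (T C : Type) (e : rel T) (f : T -> C) : Prop :=
  forall z x y, e z x -> e z y -> f x = f y -> x = y.

Lemma locally_injective_comp (T T' C : Type) (e : rel T) (e' : rel T')
    (f : T -> T') (c : T' -> C) :
  {homo f : x y / e x y >-> e' x y} -> locally_injective e f ->
  locally_injective e' c -> locally_injective e (c \o f).
Proof. by move=> fe fI cI z x y zx zy /cI; eauto. Qed.

Lemma injective_colouringP (G : sgraph) (k : nat) (c : {ffun G -> 'I_k}) :
  reflect (locally_injective (@edge G) c) (injective_colouring c).
Proof.
apply: (iffP forallP) => [cP z x y zx zy cxy | cI x].
  apply/eqP; apply: contraTT (forallP (cP x) y) => xy.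
  rewrite xy cxy eqxx implybF negbK; apply/existsP; exists z.
  by rewrite edge_sym zx edge_sym.
apply/forallP=> y; apply/implyP=> /andP[xy /existsP[z /andP[xz yz]]].
by apply: contra_neq xy; apply: (cI z); rewrite edge_sym.
Qed.

Lemma injectively_colourableP (G : sgraph) (k : nat) :
  (exists c : G -> 'I_k, locally_injective (@edge G) c) <->
  injectively_colourable G k.
Proof.
split=> [[c cI] | /existsP[c /injective_colouringP cI]]; last by exists c.
by apply/existsP; exists (finfun c); apply/injective_colouringP => z x y zx zy;
  rewrite !ffunE; apply: cI zx zy.
Qed.

Lemma locally_injective_enum (T C : eqType) (e : rel T) (f : T -> C)
    (s : seq T) :
  (forall x, x \in s) ->
  all (fun z => uniq [seq f x | x <- s & e z x]) s -> locally_injective e f.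
Proof.
move=> sT /allP fU z x y zx zy fxy.
have xs : x \in [seq u <- s | e z u] by rewrite mem_filter zx sT.
have ys : y \in [seq u <- s | e z u] by rewrite mem_filter zy sT.
have := fU z (sT z); elim: [seq u <- s | e z u] xs ys => //= u t IHt.
rewrite !inE => /predU1P[xu | xt] /predU1P[yu | yt] /andP[ft] //.
- by rewrite xu yu.
- by case/negP: ft; rewrite -xu fxy map_f.
- by case/negP: ft; rewrite -yu -fxy map_f.
- exact: IHt.
Qed.

End LocallyInjective.

(* Unlike [enum 'I_n.+1], this enumeration computes. *)
Definition ord_seq (n : nat) : seq 'I_n.+1 :=
  [seq Ordinal (ltn_pmod i (ltn0Sn n)) | i <- iota 0 n.+1].

Lemma mem_ord_seq (n : nat) (x : 'I_n.+1) : x \in ord_seq n.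
Proof.
apply/mapP; exists (val x); first by rewrite mem_iota ltn_ord.
by apply: val_inj; rewrite /= modn_small.
Qed.

Lemma ord3_other (j k : 'I_3) : exists l : 'I_3, (l != j) && (l != k).
Proof.
suff /hasP[l _ jlk] : has (fun l => (l != j) && (l != k)) (ord_seq 2)
  by exists l.
by case: j => -[|[|[]]] //; case: k => -[|[|[]]].
Qed.

(** * The open step and its folding map *)

Section OpenStep.

Variables (G : sgraph) (v : 'I_3 -> G).
Hypothesis v_triangle : forall j k, edge (v j) (v k) = (j != k).

Definition on_triangle (p : G) : bool := has (fun j => p == v j) (ord_seq 2).

Definition open_step_edge : rel (G + 'I_3)%type := fun x y =>
  match x, y with
  | inl p, inl q => edge p q && ~~ (on_triangle p && on_triangle q)
  | inl p, inr k | inr k, inl p => on_triangle p && (p != v k)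
  | inr _, inr _ => false
  end.

Definition fold_step (x : G + 'I_3) : G :=
  match x with inl p => p | inr j => v j end.

Lemma on_triangleP (p : G) : reflect (exists j, p = v j) (on_triangle p).
Proof.
by apply: (iffP hasP) => [[j _ /eqP] | [j ->]]; exists j; rewrite ?mem_ord_seq.
Qed.

Lemma on_triangle_v (j : 'I_3) : on_triangle (v j).
Proof. by apply/on_triangleP; exists j. Qed.

Lemma triangle_eq (j k : 'I_3) : (v j == v k) = (j == k).
Proof.
apply/eqP/eqP=> [vjk | -> //]; apply/eqP.
by rewrite -[_ == _]negbK -v_triangle vjk edge_irr.
Qed.

(** Since distinct [v j] are adjacent, an old edge is erased exactly when both its ends lie on the
    triangle. *)
Lemma step_edgeE (x y : G + 'I_3) :
  step_edge v x y =
    match x, y with inr j, inr k => j != k | _, _ => open_step_edge x y end.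
Proof.
have outE p k :
    [exists j, (k != j) && (p == v j)] = on_triangle p && (p != v k).
  apply/existsP/andP=> [[j /andP[kj /eqP->]] | [/on_triangleP[j ->] jk]].
    by rewrite on_triangle_v triangle_eq eq_sym.
  by exists j; rewrite eqxx andbT eq_sym -triangle_eq.
case: x y => [p|j] [q|k] //=; apply: andb_id2l => pq; congr (~~ _).
apply/existsP/andP=> [[j /existsP[k /and3P[_ /eqP-> /eqP->]]] | ].
  by rewrite !on_triangle_v.
move=> [/on_triangleP[j pj] /on_triangleP[k qk]]; exists j; apply/existsP.
by exists k; rewrite pj qk !eqxx -v_triangle -pj -qk pq.
Qed.

Lemma fold_step_edge : {homo fold_step : x y / open_step_edge x y >-> edge x y}.
Proof.
move=> [p|j] [q|k] //= => [/andP[] // | |] /andP[/on_triangleP[l ->]].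
  by rewrite v_triangle triangle_eq.
by rewrite v_triangle triangle_eq eq_sym.
Qed.

(** Only [inl (v k)] and [inr k] are identified. All neighbours of [inr k] lie on the triangle [v],
    whose edges are erased, so the two share none. *)
Lemma fold_step_locally_injective : locally_injective open_step_edge fold_step.
Proof.
move=> [r|l] [p|j] [q|k] //=.
- by move=> _ _ ->.
- by move=> /andP[_ rp] /andP[rv _] pk; rewrite rv pk on_triangle_v in rp.
- by move=> /andP[rv _] /andP[_ rp] pk; rewrite rv -pk on_triangle_v in rp.
- by move=> _ _ /eqP; rewrite triangle_eq => /eqP->.
- by move=> _ _ ->.
Qed.

Lemma fold_step_colouring (C : Type) (c : G -> C) :
  locally_injective (@edge G) c ->
  locally_injective open_step_edge (c \o fold_step).
Proof.
apply: locally_injective_comp fold_step_edge fold_step_locally_injective.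
Qed.

(** Two vertices of a triangle have the third as a common neighbour. *)
Lemma triangle_colouring (C : Type) (c : G -> C) :
  locally_injective (@edge G) c -> injective (c \o v).
Proof.
move=> cI j k cjk; have [l /andP[lj lk]] := ord3_other j k.
by apply/eqP; rewrite -triangle_eq; apply/eqP; apply: (cI (v l));
  rewrite ?v_triangle.
Qed.

End OpenStep.

(** * Restriction and extension across steps *)

Lemma step_triangleP (G : sgraph) (v : 'I_3 -> G) (j k : 'I_3) :
  edge (step_triangle v j) (step_triangle v k) = (j != k).
Proof. by []. Qed.

Lemma open_step_edge_inl (G : sgraph) (v : 'I_3 -> G) (x y : step v) :
  (forall j k, edge (v j) (v k) = (j != k)) ->
  open_step_edge (step_triangle v) (inl x) (inl y) = open_step_edge v x y.
Proof.
move=> v_triangle.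
have old p : on_triangle (step_triangle v) (inl p) = false.
  by apply/on_triangleP => -[].
have new j : on_triangle (step_triangle v) (inr j) := on_triangle_v _ j.
rewrite [LHS]/= (step_edgeE v_triangle).
by case: x y => [p|j] [q|k]; rewrite ?old ?new ?andbF ?andbT.
Qed.

Lemma open_step_colouring_inl (G : sgraph) (v : 'I_3 -> G) (C : Type)
    (c : step v + 'I_3 -> C) :
  (forall j k, edge (v j) (v k) = (j != k)) ->
  locally_injective (open_step_edge (step_triangle v)) c ->
  locally_injective (open_step_edge v) (c \o inl).
Proof.
move=> v_triangle; apply: locally_injective_comp => [x y | z x y _ _ []//].
by rewrite open_step_edge_inl.
Qed.

Lemma two_step_colouring (G : sgraph) (v : 'I_3 -> G) (C : finType)
    (c : G -> C) :
  (forall j k, edge (v j) (v k) = (j != k)) -> 5 < #|C| ->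
  locally_injective (@edge G) c ->
  exists c' : step (step_triangle v) -> C, locally_injective (@edge _) c'.
Proof.
move=> v_triangle C6 cI.
have cvI := triangle_colouring v_triangle cI.
(* The triangle [v] uses exactly three colours, leaving three for the second new triangle. *)
have le3 : 3 <= #|[predC codom (c \o v)]|.
  by rewrite -(leq_add2l #|codom (c \o v)|) cardC card_codom // card_ord.
pose d (j : 'I_3) := enum_val (widen_ord le3 j).
have dI : injective d by move=> j k /enum_val_inj/(congr1 val)/= /val_inj.
have dv j k : d j != c (v k).
  have := enum_valP (widen_ord le3 j); rewrite -/(d j) inE /=.
  by apply: contraNneq => ->; apply: (codom_f (c \o v)).
pose c0 := c \o fold_step v.
have c0I : locally_injective (open_step_edge v) c0.
  exact: fold_step_colouring cI.
exists (fun x => match x with inl x => c0 x | inr j => d j end).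
have inlE x y :
    edge (inl x : step (step_triangle v)) (inl y) = open_step_edge v x y.
  by rewrite [LHS](step_edgeE (@step_triangleP _ v)) open_step_edge_inl.
have inrE (x : step v) (k : 'I_3) :
    edge (inr k : step (step_triangle v)) (inl x) -> exists l, x = inr l.
  rewrite [edge _ _](step_edgeE (@step_triangleP _ v)).
  by case/andP => /on_triangleP.
(* A vertex [x] sharing a neighbour with the second new triangle lies on [v] or on the first new
   triangle, so its colour occurs on [v], whereas [d] avoids those colours. *)
have cd z x k : edge z (inl x : step (step_triangle v)) -> edge z (inr k) ->
    c0 x = d k -> False.
  move=> zx zk xk; suff [l xl] : exists l, fold_step v x = v l.
    by case/eqP: (dv k l); rewrite -xk /c0 /= xl.
  case: z zx zk => [w|j]; last by move=> /inrE[l ->] _; exists l.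
  rewrite inlE edge_sym => wx /inrE[j wj]; move: wx; rewrite wj.
  by case: x {xk} => [p|l] //= /andP[/on_triangleP].
move=> z [x|j] [y|k] zx zy.
- case: z zx zy => [z|j]; first by rewrite !inlE => zx zy /(c0I _ _ _ zx zy)->.
  by move=> /inrE[l ->] /inrE[m ->] /cvI->.
- by move/(cd _ _ _ zx zy).
- by move/esym/(cd _ _ _ zy zx).
- by move/dI->.
Qed.

(** * Exhaustive search for colourings *)

Section ColouringSearch.

Variables (T C : eqType) (conflict : rel T) (n : nat).

Fixpoint insertions (x : T) (cls : seq (seq T)) : seq (seq (seq T)) :=
  if cls is cl :: cls' then
    let rest := [seq cl :: cls'' | cls'' <- insertions x cls'] in
    if has (conflict x) cl then rest else ((x :: cl) :: cls') :: rest
  else [::].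

(* Tries to distribute [s] over the conflict-free classes [cls] and new ones,
   up to [n] classes; opening at most one new class at a time avoids exploring
   permutations of the colours.  The conditional, unlike [&&], keeps
   [vm_compute] from evaluating the search when no class may be opened. *)
Fixpoint search (s : seq T) (cls : seq (seq T)) : bool :=
  if s is x :: s' then
    has (search s') (insertions x cls) ||
    (if size cls < n then search s' ([:: x] :: cls) else false)
  else true.

Definition is_class (c : T -> C) (k : C) (cl : seq T) : bool :=
  all (fun x => c x == k) cl.

Lemma mem_insertions (c : T -> C) (x : T) (ks : seq C) (cls : seq (seq T)) :
  (forall x y, conflict x y -> c x != c y) ->
  all2 (is_class c) ks cls -> c x \in ks ->
  exists2 cls', cls' \in insertions x cls & all2 (is_class c) ks cls'.
Proof.
move=> cP; elim: ks cls => [|k ks IHks] [|cl cls] //= /andP[ck cks].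
rewrite inE; have [xk _ | _ /=] := eqVneq (c x) k.
  exists ((x :: cl) :: cls); last by rewrite /= xk eqxx ck.
  case: ifPn => [/hasP[y /(allP ck)/eqP yk /cP] | _]; last exact: mem_head.
  by rewrite xk yk eqxx.
move=> /(IHks _ cks)[cls' cls'P cks'].
exists (cl :: cls'); last by rewrite /= ck.
by have m := map_f (cons cl) cls'P; case: ifP => _; rewrite ?inE m ?orbT.
Qed.

(** The search can follow [c]: with [ks] the colours of the current classes, the next vertex joins
    the class of its colour or opens a new one, and distinct colours keep the count within [n]. *)
Lemma search_complete (c : T -> C) (s : seq T) (ks : seq C)
    (cls : seq (seq T)) :
  (forall x y, conflict x y -> c x != c y) ->
  (forall ks : seq C, uniq ks -> size ks <= n) ->
  uniq ks -> all2 (is_class c) ks cls -> search s cls.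
Proof.
move=> cP Cn; elim: s ks cls => //= x s IHs ks cls Uks cks.
have [xks | xks] := boolP (c x \in ks).
  have [cls' cls'P cks'] := mem_insertions cP cks xks.
  by apply/orP; left; apply/hasP; exists cls'; last exact: IHs cks'.
have Uxks : uniq (c x :: ks) by rewrite /= xks.
have <- : size ks = size cls by move: cks; rewrite all2E => /andP[/eqP].
by rewrite (Cn _ Uxks) (IHs _ _ Uxks) ?orbT //= eqxx.
Qed.

End ColouringSearch.

Definition share_neighbour (T : eqType) (e : rel T) (s : seq T) : rel T :=
  fun x y => (x != y) && has (fun z => e z x && e z y) s.

(** Every conflict recorded is a genuine one, so a failed search on any list [s] refutes
    colourability. *)
Lemma locally_injective_search (T : eqType) (C : finType) (e : rel T)
    (c : T -> C) (n : nat) (s : seq T) :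
  #|C| <= n -> locally_injective e c -> search (share_neighbour e s) n s [::].
Proof.
move=> Cn cI; apply: (@search_complete T C _ _ c s [::]) => //.
  move=> x y /andP[xy /hasP[z _ /andP[zx zy]]].
  by apply: contra_neq xy; apply: cI zx zy.
by move=> ks /card_uniqP <-; apply: leq_trans (max_card _) Cn.
Qed.

(* [old j] is the vertex a_j. *)
Definition old (j : nat) : G40 + 'I_3 :=
  inl (Ordinal (ltn_pmod j.-1 (isT : 0 < 15)) : G40).

Definition new (j : nat) : G40 + 'I_3 :=
  inr (Ordinal (ltn_pmod j (isT : 0 < 3))).

(* A random search over vertex orders gave this one, whose search tree has
   122 nodes. *)
Definition search_order : seq (G40 + 'I_3) :=
  map old [:: 3; 4; 12; 9; 11; 15; 7; 8; 6; 13; 5; 1; 2; 10; 14] ++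
  map new [:: 2; 1; 0].

Lemma open_step_G40_search :
  search (share_neighbour (open_step_edge G40_triangle) search_order) 7
    search_order [::] = false.
Proof. by vm_compute. Qed.

(** * Colourings of the family and the lower bound *)

Definition colour8 (s : seq nat) (i : nat) : 'I_8 :=
  Ordinal (ltn_pmod (nth 0 s i) (isT : 0 < 8)).

Lemma G4_0_colouring :
  exists c : G4 0 -> 'I_8, locally_injective (@edge (G4 0)) c.
Proof.
exists (fun x : 'I_15 =>
  colour8 [:: 0; 1; 2; 3; 4; 0; 3; 1; 4; 5; 5; 6; 2; 6; 7] x).
by apply: (locally_injective_enum (@mem_ord_seq 14)); vm_compute.
Qed.

Lemma G4_1_colouring :
  exists c : G4 1 -> 'I_8, locally_injective (@edge (G4 1)) c.
Proof.
pose c (x : G4 1) := match x with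
  | inl p => colour8 [:: 0; 1; 2; 3; 4; 0; 1; 2; 4; 3; 5; 6; 6; 5; 7] p
  | inr j => colour8 [:: 4; 2; 7] j end.
(* Unlike [step_edge], with its boolean quantifiers, [e] computes. *)
pose e (x y : G4 1) := match x, y with
  | inr j, inr k => j != k
  | _, _ => open_step_edge G40_triangle x y end.
have eE : @edge (G4 1) =2 e := step_edgeE (@G4_triangleP 0).
exists c => z x y; rewrite !eE; move: z x y.
apply: (@locally_injective_enum _ _ e c
  ([seq inl p | p <- ord_seq 14] ++ [seq inr j | j <- ord_seq 2])).
  by case=> [p|j]; rewrite mem_cat map_f ?orbT // mem_ord_seq.
by vm_compute.
Qed.

Lemma G4_colouring (i : nat) :
  exists c : G4 i -> 'I_8, locally_injective (@edge (G4 i)) c.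
Proof.
(* Colourings extend two steps at a time, so the induction carries two consecutive indices. *)
suff [] : (exists c : G4 i -> 'I_8, locally_injective (@edge (G4 i)) c) /\
  (exists c : G4 i.+1 -> 'I_8, locally_injective (@edge (G4 i.+1)) c) by [].
elim: i => [|i [[c cI] IHi]]; first exact: (conj G4_0_colouring G4_1_colouring).
split=> //; apply: two_step_colouring cI; first exact: G4_triangleP.
by rewrite card_ord.
Qed.

Lemma open_step_G4_colouring (i : nat) (C : Type) (c : G4 i + 'I_3 -> C) :
  locally_injective (open_step_edge (G4_triangle i)) c ->
  exists c0 : G40 + 'I_3 -> C,
    locally_injective (open_step_edge G40_triangle) c0.
Proof.
elim: i c => [|i IHi] c cI; first by exists c.
exact: IHi (open_step_colouring_inl (@G4_triangleP i) cI).
Qed.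

Lemma G4_colouring_ge8 (i n : nat) (c : G4 i -> 'I_n) :
  locally_injective (@edge (G4 i)) c -> 7 < n.
Proof.
move=> cI; rewrite ltnNge; apply/negP=> n7.
have [c0 c0I] :=
  open_step_G4_colouring (fold_step_colouring (@G4_triangleP i) cI).
have C7 : #|'I_n| <= 7 by rewrite card_ord.
by have := locally_injective_search search_order C7 c0I;
  rewrite open_step_G40_search.
Qed.

Theorem theorem7 (G : sgraph) : G4_family G -> injective_chromatic_number G = 8.
Proof.
move=> [i ->]; rewrite /injective_chromatic_number.
case: ex_minnP => k /andP[_ /injectively_colourableP[c cI]] kP.
apply/eqP; rewrite eqn_leq (G4_colouring_ge8 cI) andbT kP //=.
exact/injectively_colourableP/G4_colouring.
Qed.
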